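(* The rules of the graphical calculus ZQ are sound with respect to its standard interpretation: for each of the rules (S), (Q), (Y), (N), (I$_q$), (I$_z$), (A), (M), (I$_1$), (B), (CP), (P) of ZQ, the two sides of the rule have the same interpretation as complex matrices (for all values of the parameters in the rule).
   Context: Quaternions are written $q=q_w+iq_x+jq_y+kq_z$ with $i^2=j^2=k^2=ijk=-1$. For an angle $\alpha$ and a unit vector $v\in\mathbb R^3$ write $(\alpha,v):=\cos\frac\alpha2+\sin\frac\alpha2(iv_x+jv_y+kv_z)$; $z$ denotes the unit vector $(0,0,1)$, and $H:=\frac1{\sqrt2}(i+k)$. For a quaternion $q$ let $\tilde q:=q_w+iq_x-jq_y+kq_z$. ZQ is the compact closed PROP (wires, swaps, cups, caps) with generators $Z_{m}^{n}:m\to n$ (Z spider, $m,n\ge0$), $Q_q:1\to1$ for each unit-length quaternion $q$, and $\lambda_c:0\to0$ for each $c\in\mathbb C$. Z spiders are regarded as invariant under permuting their legs and under bending legs with cups and caps. $Q_q^T:1\to1$ denotes the transpose of $Q_q$, formed from $Q_q$ with a cup and a cap. Standard interpretation (strict symmetric monoidal functor into complex matrices): $\llbracket Z_m^n\rrbracket=|0\rangle^{\otimes n}\langle0|^{\otimes m}+|1\rangle^{\otimes n}\langle1|^{\otimes m}$; $\llbracket Q_q\rrbracket=\begin{pmatrix} q_w-iq_z & -q_y-iq_x \\ {q_y-iq_x} & q_w+iq_z \end{pmatrix}$; $\llbracket\lambda_c\rrbracket=c$; cup $=(1\,0\,0\,1)^T$, cap $=(1\,0\,0\,1)$, wire $=I_2$,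 swap $|xy\rangle\mapsto|yx\rangle$. Rules (juxtaposition of a scalar with a diagram means tensor product): (S) two Z spiders connected by one or more wires fuse to a single Z spider with the remaining legs; (Q) $Q_{q_1}\circ Q_{q_2}=Q_{q_1q_2}$; (Y) $Q_q^T=Q_{\tilde q}$; (N) $\lambda_{-1}Q_q=Q_{-q}$; (I$_q$) $Q_1=\mathrm{id}_1$; (I$_z$) $Z_1^1=\mathrm{id}_1$; (A) $Z_1^0\circ Q_q\circ Z_0^1=\lambda_{2(q_w-iq_x)}$ (here $i$ in the subscript is the complex unit); (M) $\lambda_x\lambda_y=\lambda_{xy}$; (I$_1$) $\lambda_1=$ empty diagram; (B) $\lambda_{-\sqrt2i}\,(Z_2^1\otimes Z_2^1)\circ Q_H^{\otimes4}\circ(\mathrm{id}\otimes\mathrm{swap}\otimes\mathrm{id})\circ(Z_1^2\otimes Z_1^2)=Q_H^{\otimes2}\circ Z_1^2\circ Q_H\circ Z_2^1\circ Q_H^{\otimes2}$; (CP) $Z_1^0\circ Q_H\circ Z_2^1=\lambda_{i/\sqrt2}\,(Z_1^0\circ Q_H)^{\otimes2}$; (P) $Z_2^1\circ(Q_{(\alpha,z)}\otimes\mathrm{id})=Z_2^1\circ(\mathrm{id}\otimes Q_{(\alpha,z)})$ for every angle $\alpha$. *)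

(* Defs.v *)
From HB Require Import structures.
From mathcomp Require Import all_boot all_order all_algebra.
From mathcomp Require Import mxtens complex.
From mathcomp Require Import reals trigo.
From mathcomp Require Import ring lra.

Set Implicit Arguments.
Unset Strict Implicit.
Unset Printing Implicit Defensive.

Import Order.TTheory GRing.Theory Num.Theory.

Local Open Scope ring_scope.

Declare Scope zq_scope.
Delimit Scope zq_scope with ZQ.

Reserved Notation "g ∘ f" (at level 40, left associativity).
Reserved Notation "f ⊗ g" (at level 38, right associativity).
Reserved Notation "D1 ≅ D2" (at level 70, no associativity).

(** * Quaternions *)

Record quat (R : Type) : Type := Quat { qw : R; qx : R; qy : R; qz : R }.

Section Quaternions.
Variable R : realType.
Implicit Types p q : quat R.

Definition qnorm q : R :=
  Num.sqrt (qw q ^+ 2 + qx q ^+ 2 + qy q ^+ 2 + qz q ^+ 2).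

(* Hamilton's product, from i^2 = j^2 = k^2 = ijk = -1. *)
Definition qmul p q : quat R :=
  Quat (qw p * qw q - qx p * qx q - qy p * qy q - qz p * qz q)
       (qw p * qx q + qx p * qw q + qy p * qz q - qz p * qy q)
       (qw p * qy q - qx p * qz q + qy p * qw q + qz p * qx q)
       (qw p * qz q + qx p * qy q - qy p * qx q + qz p * qw q).

Definition qopp q : quat R := Quat (- qw q) (- qx q) (- qy q) (- qz q).

Definition qtilde q : quat R := Quat (qw q) (qx q) (- qy q) (qz q).

(* The quaternion (alpha, v), for v = (vx, vy, vz). *)
Definition axis_angle (alpha vx vy vz : R) : quat R :=
  Quat (cos (alpha / 2)) (sin (alpha / 2) * vx)
       (sin (alpha / 2) * vy) (sin (alpha / 2) * vz).

Record uquat : Type := UQuat { uq :> quat R; uqP : qnorm uq == 1 }.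

Lemma qnorm_eq1 q :
  (qnorm q == 1) = (qw q ^+ 2 + qx q ^+ 2 + qy q ^+ 2 + qz q ^+ 2 == 1).
Proof.
by rewrite /qnorm -[X in X = _](eqrXn2 (n := 2)) ?sqrtr_ge0 // expr1n
  sqr_sqrtr // !addr_ge0 // sqr_ge0.
Qed.

Lemma umul_proof (p q : uquat) : qnorm (qmul p q) == 1.
Proof.
case: p q => [p hp] [q hq] /=; move: hp hq.
rewrite !qnorm_eq1 => /eqP hp /eqP hq; apply/eqP.
rewrite -[RHS](mulr1 1) -[in X in X * _]hp -[in X in _ * X]hq /=; ring.
Qed.
Definition umul (p q : uquat) : uquat := UQuat (umul_proof p q).

Lemma uopp_proof (q : uquat) : qnorm (qopp q) == 1.
Proof. by case: q => q /=; rewrite !qnorm_eq1 /= !sqrrN. Qed.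
Definition uopp (q : uquat) : uquat := UQuat (uopp_proof q).

Lemma utilde_proof (q : uquat) : qnorm (qtilde q) == 1.
Proof. by case: q => q /=; rewrite !qnorm_eq1 /= !sqrrN. Qed.
Definition utilde (q : uquat) : uquat := UQuat (utilde_proof q).

Lemma uone_proof : qnorm (Quat 1 0 0 0) == 1.
Proof. by rewrite qnorm_eq1 /=; apply/eqP; ring. Qed.
Definition uone : uquat := UQuat uone_proof.

Lemma urotz_proof (alpha : R) : qnorm (axis_angle alpha 0 0 1) == 1.
Proof.
by rewrite qnorm_eq1 /= !mulr0 mulr1 expr0n !addr0 cos2Dsin2.
Qed.
Definition urotz (alpha : R) : uquat := UQuat (urotz_proof alpha).

Lemma uH_proof : qnorm (Quat 0 (Num.sqrt 2)^-1 0 (Num.sqrt 2)^-1) == 1.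
Proof.
by rewrite qnorm_eq1 /= exprVn sqr_sqrtr ?ler0n //; apply/eqP; field.
Qed.
Definition uH : uquat := UQuat uH_proof.

End Quaternions.

(** * Diagrams *)

(* [diagram R m n] is the type of diagram terms from m wires to n wires. The
   morphisms of the PROP are these terms modulo [diag_equiv], below. *)
Inductive diagram (R : realType) : nat -> nat -> Type :=
| Idn (n : nat) : diagram R n n
| Swap (m n : nat) : diagram R (m + n) (n + m)
| Cup : diagram R 0 2
| Cap : diagram R 2 0
| Zsp (m n : nat) : diagram R m n
| Qgen (q : uquat R) : diagram R 1 1
| Lam (c : R[i]) : diagram R 0 0
| Comp (m n p : nat) (g : diagram R n p) (f : diagram R m n) : diagram R m p
| Tens (m n m' n' : nat) (f : diagram R m n) (g : diagram R m' n') :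
    diagram R (m + m') (n + n').

Arguments Idn {R} n.
Arguments Swap {R} m n.
Arguments Cup {R}.
Arguments Cap {R}.
Arguments Zsp {R} m n.
Arguments Qgen {R} q.
Arguments Lam {R} c.

Bind Scope zq_scope with diagram.
Notation "g ∘ f" := (Comp g f) : zq_scope.
Notation "f ⊗ g" := (Tens f g) : zq_scope.

(* Associativity and right-unitality of the tensor hold strictly in a PROP,
   but m + (n + p) and (m + n) + p are not convertible. *)
Definition castd (R : realType) (m n m' n' : nat) (em : m = m') (en : n = n')
    (D : diagram R m n) : diagram R m' n' :=
  ecast m0 (diagram R m0 n') em (ecast n0 (diagram R m n0) en D).

Definition transpose (R : realType) (D : diagram R 1 1) : diagram R 1 1 :=
  ((Cap ⊗ Idn 1) ∘ (Idn 1 ⊗ D ⊗ Idn 1) ∘ (Idn 1 ⊗ Cup))%ZQ.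

(** * Equality of diagrams in the PROP *)

(* The congruence generated by the axioms of a symmetric strict monoidal
   category whose object 1 is self-dual, together with the invariance of Z
   spiders under permuting and bending their legs. It contains no rule of the
   calculus. *)
Inductive diag_equiv (R : realType) :
    forall m n : nat, diagram R m n -> diagram R m n -> Prop :=
| de_refl m n (f : diagram R m n) : (f ≅ f)
| de_sym m n (f g : diagram R m n) : (f ≅ g) -> (g ≅ f)
| de_trans m n (f g h : diagram R m n) : (f ≅ g) -> (g ≅ h) -> (f ≅ h)
| de_comp m n p (g g' : diagram R n p) (f f' : diagram R m n) :
    (g ≅ g') -> (f ≅ f') -> (g ∘ f)%ZQ ≅ (g' ∘ f')%ZQ
| de_tens m n m' n' (f f' : diagram R m n) (g g' : diagram R m' n') :
    (f ≅ f') -> (g ≅ g') -> (f ⊗ g)%ZQ ≅ (f' ⊗ g')%ZQ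
| de_compA m n p q (h : diagram R p q) (g : diagram R n p) (f : diagram R m n) :
    (h ∘ (g ∘ f))%ZQ ≅ (h ∘ g ∘ f)%ZQ
| de_compIl m n (f : diagram R m n) : (Idn n ∘ f)%ZQ ≅ f
| de_compIr m n (f : diagram R m n) : (f ∘ Idn m)%ZQ ≅ f
| de_tensA m n m' n' m'' n''
    (f : diagram R m n) (g : diagram R m' n') (h : diagram R m'' n'') :
    castd (addnA m m' m'') (addnA n n' n'') (f ⊗ (g ⊗ h))%ZQ ≅ ((f ⊗ g) ⊗ h)%ZQ
| de_tens0l m n (f : diagram R m n) : (Idn 0 ⊗ f)%ZQ ≅ f
| de_tens0r m n (f : diagram R m n) :
    castd (addn0 m) (addn0 n) (f ⊗ Idn 0)%ZQ ≅ f
| de_tensI m n : (Idn m ⊗ Idn n)%ZQ ≅ Idn (m + n)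
| de_interchange m n p m' n' p' (g : diagram R n p) (f : diagram R m n)
    (g' : diagram R n' p') (f' : diagram R m' n') :
    ((g ∘ f) ⊗ (g' ∘ f'))%ZQ ≅ ((g ⊗ g') ∘ (f ⊗ f'))%ZQ
| de_swap_nat m n m' n' (f : diagram R m n) (g : diagram R m' n') :
    (Swap n n' ∘ (f ⊗ g))%ZQ ≅ ((g ⊗ f) ∘ Swap m m')%ZQ
| de_swapK m n : (Swap n m ∘ Swap m n)%ZQ ≅ Idn (m + n)
| de_swap_hexagon m n p :
    Swap m (n + p) ≅
    castd (esym (addnA m n p)) (addnA n p m)
      ((Idn n ⊗ Swap m p) ∘
       castd (erefl _) (esym (addnA n m p)) (Swap m n ⊗ Idn p))%ZQ
| de_snakel : ((Cap ⊗ Idn 1) ∘ (Idn 1 ⊗ Cup))%ZQ ≅ Idn 1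
| de_snaker : ((Idn 1 ⊗ Cap) ∘ (Cup ⊗ Idn 1))%ZQ ≅ Idn 1
| de_cup_swap : (Swap 1 1 ∘ Cup)%ZQ ≅ Cup
| de_cap_swap : (Cap ∘ Swap 1 1)%ZQ ≅ Cap
| de_Z_perm_out m a b :
    ((Idn a ⊗ Swap 1 1 ⊗ Idn b) ∘ Zsp m (a + (2 + b)))%ZQ ≅
    Zsp m (a + (2 + b))
| de_Z_perm_in n a b :
    (Zsp (a + (2 + b)) n ∘ (Idn a ⊗ Swap 1 1 ⊗ Idn b))%ZQ ≅
    Zsp (a + (2 + b)) n
| de_Z_bend_out m n :
    ((Idn 1 ⊗ Zsp (1 + m) n) ∘ (Cup ⊗ Idn m))%ZQ ≅ Zsp m (1 + n)
| de_Z_bend_in m n :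
    ((Cap ⊗ Idn n) ∘ (Idn 1 ⊗ Zsp m (1 + n)))%ZQ ≅ Zsp (1 + m) n
where "D1 ≅ D2" := (diag_equiv D1 D2).

Notation "D1 ≅ D2" := (diag_equiv D1 D2) : type_scope.

(** * The rules *)

Section Rules.
Variable R : realType.

Inductive ZQ_rule : forall m n : nat, diagram R m n -> diagram R m n -> Prop :=
(* k.+1 is the number of connecting wires; the remaining legs are a inputs and
   b outputs of the first spider, and c inputs and d outputs of the second. *)
| rule_S (a b c d k : nat) : ZQ_rule
    ((Idn b ⊗ Zsp (k.+1 + c) d) ∘
     castd (erefl _) (esym (addnA b k.+1 c)) (Zsp a (b + k.+1) ⊗ Idn c))%ZQ
    (Zsp (a + c) (b + d))
| rule_Q (q1 q2 : uquat R) : ZQ_rule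
    (Qgen q1 ∘ Qgen q2)%ZQ
    (Qgen (umul q1 q2))
| rule_Y (q : uquat R) : ZQ_rule
    (transpose (Qgen q))
    (Qgen (utilde q))
| rule_N (q : uquat R) : ZQ_rule
    (Lam (-1) ⊗ Qgen q)%ZQ
    (Qgen (uopp q))
| rule_Iq : ZQ_rule
    (Qgen (uone R))
    (Idn 1)
| rule_Iz : ZQ_rule
    (Zsp 1 1)
    (Idn 1)
| rule_A (q : uquat R) : ZQ_rule
    (Zsp 1 0 ∘ Qgen q ∘ Zsp 0 1)%ZQ
    (Lam (2 * (qw q -i* qx q)%C))
| rule_M (x y : R[i]) : ZQ_rule
    (Lam x ⊗ Lam y)%ZQ
    (Lam (x * y))
| rule_I1 : ZQ_rule
    (Lam 1)
    (Idn 0)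
| rule_B : ZQ_rule
    (Lam (- (Num.sqrt 2)%:C%C * (0 +i* 1)%C) ⊗
     ((Zsp 2 1 ⊗ Zsp 2 1) ∘
      (Qgen (uH R) ⊗ Qgen (uH R) ⊗ Qgen (uH R) ⊗ Qgen (uH R)) ∘
      (Idn 1 ⊗ Swap 1 1 ⊗ Idn 1) ∘
      (Zsp 1 2 ⊗ Zsp 1 2)))%ZQ
    ((Qgen (uH R) ⊗ Qgen (uH R)) ∘ Zsp 1 2 ∘ Qgen (uH R) ∘ Zsp 2 1 ∘
     (Qgen (uH R) ⊗ Qgen (uH R)))%ZQ
| rule_CP : ZQ_rule
    (Zsp 1 0 ∘ Qgen (uH R) ∘ Zsp 2 1)%ZQ
    (Lam ((0 +i* 1)%C / (Num.sqrt 2)%:C%C) ⊗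
     ((Zsp 1 0 ∘ Qgen (uH R)) ⊗ (Zsp 1 0 ∘ Qgen (uH R))))%ZQ
| rule_P (alpha : R) : ZQ_rule
    (Zsp 2 1 ∘ (Qgen (urotz alpha) ⊗ Idn 1))%ZQ
    (Zsp 2 1 ∘ (Idn 1 ⊗ Qgen (urotz alpha)))%ZQ.

End Rules.

(** * The standard interpretation *)

Section Interpretation.
Variable R : realType.
Local Notation C := R[i].

Definition ket (b : 'I_2) : 'cV[C]_2 := delta_mx b 0.
Definition bra (b : 'I_2) : 'rV[C]_2 := delta_mx 0 b.

Definition ketn (b : 'I_2) (n : nat) : 'cV[C]_(2 ^ n) :=
  castmx (erefl _, exp1n n) (ket b ^t n).
Definition bran (b : 'I_2) (n : nat) : 'rV[C]_(2 ^ n) :=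
  castmx (exp1n n, erefl _) (bra b ^t n).

Definition Zmx (m n : nat) : 'M[C]_(2 ^ n, 2 ^ m) :=
  ketn 0 n *m bran 0 m + ketn 1 n *m bran 1 m.

Definition Qmx (q : quat R) : 'M[C]_2 :=
  \matrix_(i, j)
    (nth [::] [:: [:: (qw q -i* qz q)%C;     (- qy q -i* qx q)%C];
                  [:: (qy q -i* qx q)%C;     (qw q +i* qz q)%C]] i)`_j.

Definition cupmx : 'cV[C]_4 := \col_i [:: 1; 0; 0; 1]`_i.
Definition capmx : 'rV[C]_4 := \row_j [:: 1; 0; 0; 1]`_j.

(* |x>|y> |-> |y>|x> for basis vectors |x>, |y> of C^p, C^q. *)
Definition swapmx (p q : nat) : 'M[C]_(q * p, p * q) :=
  \matrix_(i, j) (mxtens_unindex i == ((mxtens_unindex j).2,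
                                       (mxtens_unindex j).1))%:R.

(* Columns index the 2 ^ m basis states of the inputs, rows the 2 ^ n basis
   states of the outputs. *)
Fixpoint interp (m n : nat) (D : diagram R m n) : 'M[C]_(2 ^ n, 2 ^ m) :=
  match D with
  | Idn n => 1%:M
  | Swap m n => castmx (esym (expnD 2 n m), esym (expnD 2 m n))
                       (swapmx (2 ^ m) (2 ^ n))
  | Cup => cupmx
  | Cap => capmx
  | Zsp m n => Zmx m n
  | Qgen q => Qmx q
  | Lam c => c%:M
  | Comp _ _ _ g f => interp g *m interp f
  | Tens m n m' n' f g =>
      castmx (esym (expnD 2 n n'), esym (expnD 2 m m')) (interp f *t interp g)
  end.

End Interpretation.

(* Main.v *)
(* Sum over paths: a diagram is given, for every pair of bit strings (y, x), the
   amplitude <y|D|x>. On strings the tensor product is strictly associative, so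
   the structural equations are splittings of strings, with no casts between
   matrix dimensions. Identities, swaps, Z_1^2 and Z_2^1 map basis vectors to
   basis vectors on one side, which collapses most of the sums; fusion holds
   because a nonempty bundle of wires carries either all 0s or all 1s. *)
Require Import Defs.
From mathcomp Require Import all_boot all_order all_algebra.
From mathcomp Require Import mxtens complex.
From mathcomp Require Import reals.
From mathcomp Require Import ring.

Set Implicit Arguments.
Unset Strict Implicit.
Unset Printing Implicit Defensive.

Import Order.TTheory GRing.Theory Num.Theory.

Local Open Scope ring_scope.

(** * Bit strings as indices of computational basis vectors *)

Section BitStrings.

Lemma size_catP (T : Type) (m n : nat) (s : seq T) : size s = (m + n)%N ->
  exists u v, [/\ size u = m, size v = n & s = u ++ v].
Proof.
move=> hs; exists (take m s), (drop m s).
by rewrite size_drop hs addKn cat_take_drop size_takel // hs leq_addr.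
Qed.

Lemma size1P (T : Type) (s : seq T) : size s = 1%N -> exists a, s = [:: a].
Proof. by case: s => [|a []] // _; exists a. Qed.

Lemma size2P (T : Type) (s : seq T) : size s = 2 -> exists a b, s = [:: a; b].
Proof. by case: s => [|a [|b []]] // _; exists a, b. Qed.

(** The first bit is the most significant one, as the left factor is in [mxtens_index], so that
    concatenating strings corresponds to tensoring basis vectors. *)
Fixpoint bval (s : seq bool) : nat :=
  if s is b :: s' then (b * 2 ^ size s' + bval s')%N else 0%N.

Lemma bval_cat s t : bval (s ++ t) = (bval s * 2 ^ size t + bval t)%N.
Proof.
by elim: s => //= b s ->; rewrite size_cat expnD mulnDl addnA mulnA.
Qed.

Lemma bval_lt s : (bval s < 2 ^ size s)%N.
Proof.
elim: s => //= b s IH; rewrite expnS mul2n -addnn.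
by case: b; rewrite ?mul1n ?mul0n ?ltn_add2l // ltn_addl.
Qed.

Lemma bval_inj s t : size s = size t -> bval s = bval t -> s = t.
Proof.
elim: s t => [|b s IH] [|c t] //= [hs]; rewrite hs => h.
have ls := bval_lt s; rewrite hs in ls; have lt := bval_lt t.
case: b c h => [] []; rewrite ?mul1n ?mul0n ?add0n.
- by move/addnI/(IH _ hs) ->.
- by move=> h; rewrite -h ltnNge leq_addr in lt.
- by move=> h; rewrite h ltnNge leq_addr in ls.
- by move/(IH _ hs) ->.
Qed.

Lemma bval_surj n (i : 'I_(2 ^ n)) : exists2 s, size s = n & i = bval s :> nat.
Proof.
case: i => i /=; elim: n i => [|n IH] i lt_i.
  by exists [::]; move: lt_i => //; case: i.
(* The leading bit records which half of the range contains [i]. *)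
have [lt_in|le_ni] := ltnP i (2 ^ n).
  by have [s hs ->] := IH _ lt_in; exists (false :: s); rewrite /= hs.
have [|s hs hi] := IH (i - 2 ^ n)%N.
  by rewrite ltn_subLR // addnn -mul2n -expnS.
by exists (true :: s); rewrite /= hs // mul1n -hi subnKC.
Qed.

Definition bord n (s : seq bool) (hs : size s = n) : 'I_(2 ^ n) :=
  Ordinal (eq_ind (size s) (fun k => bval s < 2 ^ k)%N (bval_lt s) n hs).

Lemma bord_eq n s t (hs : size s = n) (ht : size t = n) :
  (bord hs == bord ht) = (s == t).
Proof.
apply/eqP/eqP => [/(congr1 val) /= h|h].
  by apply: bval_inj; rewrite ?hs ?ht.
by apply: val_inj => /=; rewrite h.
Qed.

Lemma bord_cat m n s t (hs : size s = m) (ht : size t = n)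
    (h : size (s ++ t) = (m + n)%N) (e : (2 ^ (m + n) = 2 ^ m * 2 ^ n)%N) :
  cast_ord e (bord h) = mxtens_index (bord hs, bord ht).
Proof. by apply: val_inj; rewrite /= bval_cat ht. Qed.

End BitStrings.

(** * Sums over all bit strings of a given length *)

Section BitSum.
Variable C : comPzRingType.
Implicit Types F G : seq bool -> C.

Fixpoint bsum n F : C :=
  if n is n'.+1 then
    bsum n' (fun s => F (false :: s)) + bsum n' (fun s => F (true :: s))
  else F [::].

Lemma eq_bsum n F G : (forall s, size s = n -> F s = G s) ->
  bsum n F = bsum n G.
Proof.
elim: n F G => [|n IH] F G h /=; first exact: h.
by congr (_ + _); apply: IH => s hs; apply: h; rewrite /= hs.
Qed.

Lemma bsumD n F G : bsum n (fun s => F s + G s) = bsum n F + bsum n G.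
Proof. by elim: n F G => [|n IH] F G //=; rewrite !IH addrACA. Qed.

Lemma bsumZl n c F : bsum n (fun s => c * F s) = c * bsum n F.
Proof. by elim: n F => [|n IH] F //=; rewrite !IH mulrDr. Qed.

Lemma bsumZr n c F : bsum n (fun s => F s * c) = bsum n F * c.
Proof. by elim: n F => [|n IH] F //=; rewrite !IH mulrDl. Qed.

Lemma bsum_cat m n F :
  bsum (m + n) F = bsum m (fun s => bsum n (fun t => F (s ++ t))).
Proof. by elim: m F => //= m IH F; rewrite !IH. Qed.

Lemma exchange_bsum m n (F : seq bool -> seq bool -> C) :
  bsum m (fun s => bsum n (F s)) = bsum n (fun t => bsum m (F^~ t)).
Proof. by elim: m F => //= m IH F; rewrite !IH -bsumD. Qed.

Lemma bsum_delta n x F : size x = n ->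
  bsum n (fun s => (s == x)%:R * F s) = F x.
Proof.
elim: n x F => [|n IH] [|b x] F //= hx; first by rewrite mul1r.
case: hx => hx.
(* [E c] is the half of the sum with leading bit [c]; comparing leading bits leaves a factor
   [c == b], which kills one of the two halves. *)
pose E c := bsum n (fun s => (c :: s == b :: x)%:R * F (c :: s)).
have E1 c : E c = (c == b)%:R * F (c :: x).
  rewrite -(IH x (fun s => (c == b)%:R * F (c :: s))) //.
  by apply: eq_bsum => s _; rewrite eqseq_cons -mulnb natrM mulrCA mulrA.
by rewrite -!/(E _) !E1; case: b {E E1}; rewrite !(mul0r, mul1r, add0r, addr0).
Qed.

(** This turns the sum over indices in a matrix product into a sum over strings on the intermediate
    wires. *)
Lemma sum_ord_bsum n (f : 'I_(2 ^ n) -> C) F :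
  (forall s (hs : size s = n), f (bord hs) = F s) ->
  \sum_i f i = bsum n F.
Proof.
(* [g] extends [f] to all natural numbers, with value 0 out of range, so that the induction on [n]
   can split the range in two and shift the upper half. *)
move=> hf; pose g k := \sum_(i < 2 ^ n | i == k :> nat) f i.
have gE s : size s = n -> g (bval s) = F s.
  by move=> hs; rewrite -(hf s hs) /g (big_pred1 (bord hs)).
transitivity (\sum_(i < 2 ^ n) g i).
  apply: eq_bigr => i _; have [s hs hi] := bval_surj i.
  rewrite hi gE // -(hf s hs); congr f; exact: val_inj.
rewrite -(eq_bsum gE); move: g {gE} => g; elim: n g {f hf} => [|n IH] g /=.
  by rewrite big_ord1.
have e : (2 ^ n.+1 = 2 ^ n + 2 ^ n)%N by rewrite expnS mul2n addnn.
rewrite e big_split_ord /= IH; congr (_ + _).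
rewrite (IH (fun k => g (2 ^ n + k)%N)); apply: eq_bsum => s hs.
by rewrite hs mul1n.
Qed.

End BitSum.

(** * Amplitudes and their agreement with matrix entries *)

Section Amplitudes.
Variable R : realType.
Local Notation C := R[i].

Definition allbit (b : bool) (s : seq bool) : C := (all (pred1 b) s)%:R.

(** On the empty string both indicators are 1, so a spider without legs has amplitude 2. Inputs and
    outputs play symmetric roles. *)
Definition Zamp (s : seq bool) : C := allbit false s + allbit true s.

Definition Qamp (q : quat R) (b a : bool) : C :=
  match b, a with
  | false, false => (qw q -i* qz q)%C
  | false, true => (- qy q -i* qx q)%C
  | true, false => (qy q -i* qx q)%C
  | true, true => (qw q +i* qz q)%C
  end.

(* [amp D y x] is the amplitude <y|D|x>; it is meant for bit strings [y], [x]
   whose sizes are the numbers of outputs and inputs of [D]. Strings make the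
   tensor product strictly associative, so that [castd] becomes invisible. *)
Fixpoint amp (m n : nat) (D : diagram R m n) (y x : seq bool) : C :=
  match D with
  | Idn _ => (y == x)%:R
  | Swap m _ => (y == drop m x ++ take m x)%:R
  | Cup => (nth false y 0 == nth false y 1)%:R
  | Cap => (nth false x 0 == nth false x 1)%:R
  | Zsp _ _ => Zamp (y ++ x)
  | Qgen q => Qamp q (nth false y 0) (nth false x 0)
  | Lam c => c
  | Comp _ k _ g f => bsum k (fun z => amp g y z * amp f z x)
  | Tens m n _ _ f g =>
      amp f (take n y) (take m x) * amp g (drop n y) (drop m x)
  end.

Lemma allbit_cat b s t : allbit b (s ++ t) = allbit b s * allbit b t.
Proof. by rewrite /allbit all_cat -mulnb natrM. Qed.

Lemma ketE (b c : bool) (hc : size [:: c] = 1%N) i :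
  ket R (inord b) (bord hc) i = allbit b [:: c].
Proof.
rewrite /ket mxE (ord1 i) eqxx andbT /allbit /= andbT.
congr (_%:R); congr nat_of_bool.
by rewrite -val_eqE /= inordK; case: (b); case: (c).
Qed.

Lemma ntensmx_ket (b : bool) n y (hy : size y = n) (i : 'I_(1 ^ n)) :
  (ket R (inord b) ^t n) (bord hy) i = allbit b y.
Proof.
elim: n y hy i => [|n IH] y hy i.
  by rewrite (ord1 i); case: y hy => // hy; rewrite ntensmx0 mxE.
case: y hy => [//|c y] hy; have hy' : size y = n by case: hy.
(* The power [^t] has a separate case for exponent 1, so the recursive equation is available only
   from exponent 2 on. *)
case: n IH i hy hy' => [|n] IH i hy hy'.
  by case: y hy' hy => // _ hy; rewrite ntensmx1 ketE.
have -> : bord hy = mxtens_index (bord (erefl : size [:: c] = 1%N), bord hy').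
  by apply: val_inj; rewrite /= hy' addn0 muln1.
(* The only column index is also written as a pair, so that the entry of the tensor product
   factors. *)
rewrite -(@mxtens_unindexK 1 (1 ^ n.+1) i) ntensmxSS tensmxE IH ketE.
by rewrite (allbit_cat b [:: c] y).
Qed.

Lemma tr_ntensmx m n (A : 'M[C]_(m, n)) k : (A ^t k)^T = A^T ^t k.
Proof.
case: k => [|k]; first by rewrite !ntensmx0; apply: trmx1.
elim: k => [|k IH]; first by [].
by rewrite !ntensmxSS trmx_tens IH.
Qed.

Lemma ketnE (b : bool) n y (hy : size y = n) i :
  ketn R (inord b) n (bord hy) i = allbit b y.
Proof. by rewrite castmxE cast_ord_id ntensmx_ket. Qed.

Lemma bran_tr b n : bran R b n = (ketn R b n)^T.
Proof. by rewrite /bran /ketn trmx_cast /= tr_ntensmx /ket trmx_delta. Qed.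

Lemma ZmxE m n y x (hy : size y = n) (hx : size x = m) :
  Zmx R m n (bord hy) (bord hx) = Zamp (y ++ x).
Proof.
have e0 : 0 = inord false :> 'I_2 by apply: val_inj; rewrite /= inordK.
have e1 : 1 = inord true :> 'I_2 by apply: val_inj; rewrite /= inordK.
rewrite /Zmx !bran_tr {1 2}e0 e1 mxE 2!mxE !big_ord1.
rewrite ![(_^T) _ _]mxE !ketnE.
by rewrite -!allbit_cat.
Qed.

(** By induction on the diagram. The casts in [interp] only rename indices, and [bord_cat] matches
    this renaming with the splitting of strings. *)
Lemma amp_interp m n (D : diagram R m n) y x
    (hy : size y = n) (hx : size x = m) :
  interp D (bord hy) (bord hx) = amp D y x.
Proof.
elim: D y x hy hx => {m n} [n|m n| | |m n|q|c|m k n g IHg f IHf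
  |m n m' n' f IHf g IHg] y x hy hx /=.
- by rewrite mxE bord_eq.
- have [x1 [x2 [hx1 hx2 ex]]] := size_catP hx.
  have [y1 [y2 [hy1 hy2 ey]]] := size_catP hy.
  subst x y; rewrite drop_size_cat // take_size_cat // castmxE /= mxE.
  rewrite (bord_cat hy1 hy2) (bord_cat hx1 hx2) !mxtens_indexK /=.
  by rewrite xpair_eqE !bord_eq eqseq_cat // hy1.
- by case: y x hy hx => [|[] [|[] []]] // [] // hy hx; rewrite mxE /= ?eqxx.
- by case: x y hx hy => [|[] [|[] []]] // [] // hy hx; rewrite mxE /= ?eqxx.
- exact: ZmxE.
- by case: y x hy hx => [|[] []] // [|[] []] // hy hx; rewrite mxE.
- by rewrite mxE [bord hy]ord1 [bord hx]ord1 eqxx.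
- by rewrite mxE; apply: sum_ord_bsum => z hz; rewrite IHg IHf.
- have [y1 [y2 [hy1 hy2 ey]]] := size_catP hy.
  have [x1 [x2 [hx1 hx2 ex]]] := size_catP hx.
  subst y x; rewrite castmxE /= (bord_cat hy1 hy2) (bord_cat hx1 hx2) tensmxE.
  by rewrite IHf IHg !take_size_cat // !drop_size_cat.
Qed.

End Amplitudes.

Arguments Qamp : simpl never.

Section Soundness.
Variable R : realType.
Local Notation C := R[i].

(** * Amplitudes of composites and basis vectors sent to basis vectors *)

Lemma amp_castd m n m' n' (em : m = m') (en : n = n') (D : diagram R m n) y x :
  amp (castd em en D) y x = amp D y x.
Proof. by case: m' / em; case: n' / en. Qed.

Lemma amp_comp m n p (g : diagram R n p) (f : diagram R m n) y x :
  amp (g ∘ f)%ZQ y x = bsum n (fun z => amp g y z * amp f z x).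
Proof. by []. Qed.

Lemma amp_tens_cat m n m' n' (f : diagram R m n) (g : diagram R m' n')
    y y' x x' : size y = n -> size x = m ->
  amp (f ⊗ g)%ZQ (y ++ y') (x ++ x') = amp f y x * amp g y' x'.
Proof. by move=> hy hx /=; rewrite !take_size_cat // !drop_size_cat. Qed.

(* [sends D x u]: column [x] of the matrix of [D] is the basis vector [u];
   [receives D y u]: its row [y] is the basis vector [u]. *)
Definition sends m n (D : diagram R m n) x u :=
  [/\ size x = m, size u = n &
      forall y, size y = n -> amp D y x = (y == u)%:R].

Definition receives m n (D : diagram R m n) y u :=
  [/\ size y = n, size u = m &
      forall x, size x = m -> amp D y x = (x == u)%:R].

(** Of the sum over the intermediate wires only the term at [z] survives. *)
Lemma amp_comp_sends m n p (g : diagram R n p) (f : diagram R m n) x z y :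
  sends f x z -> amp (g ∘ f)%ZQ y x = amp g y z.
Proof.
move=> [_ hz hf] /=; rewrite -(bsum_delta (amp g y) hz).
by apply: eq_bsum => s hs; rewrite hf // mulrC.
Qed.

Lemma amp_comp_receives m n p (g : diagram R n p) (f : diagram R m n) x z y :
  receives g y z -> amp (g ∘ f)%ZQ y x = amp f z x.
Proof.
move=> [_ hz hg] /=; rewrite -(bsum_delta (amp f ^~ x) hz).
by apply: eq_bsum => s hs; rewrite hg.
Qed.

Lemma sends_castd m n m' n' (em : m = m') (en : n = n') (D : diagram R m n)
    x u :
  sends D x u -> sends (castd em en D) x u.
Proof. by case: m' / em; case: n' / en. Qed.

Lemma sends_tens m n m' n' (f : diagram R m n) (g : diagram R m' n') x x' u u' :
  sends f x u -> sends g x' u' -> sends (f ⊗ g)%ZQ (x ++ x') (u ++ u').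
Proof.
move=> [hx hu hf] [hx' hu' hg]; split; rewrite ?size_cat ?hx ?hx' ?hu ?hu' //.
move=> y /size_catP[v [v' [hv hv' ->]]].
by rewrite amp_tens_cat // hf // hg // eqseq_cat ?hv // -mulnb natrM.
Qed.

Lemma receives_tens m n m' n' (f : diagram R m n) (g : diagram R m' n')
    y y' u u' :
  receives f y u -> receives g y' u' ->
  receives (f ⊗ g)%ZQ (y ++ y') (u ++ u').
Proof.
move=> [hy hu hf] [hy' hu' hg]; split; rewrite ?size_cat ?hy ?hy' ?hu ?hu' //.
move=> x /size_catP[v [v' [hv hv' ->]]].
by rewrite amp_tens_cat // hf // hg // eqseq_cat ?hv // -mulnb natrM.
Qed.

Lemma sends_Idn n x : size x = n -> sends (Idn n : diagram R n n) x x.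
Proof. by []. Qed.

Lemma receives_Idn n x : size x = n -> receives (Idn n : diagram R n n) x x.
Proof. by move=> hx; split=> // y hy /=; rewrite eq_sym. Qed.

Lemma sends_Swap m n x y : size x = m -> size y = n ->
  sends (Swap m n : diagram R _ _) (x ++ y) (y ++ x).
Proof.
move=> hx hy; split; rewrite ?size_cat ?hx ?hy // => z hz /=.
by rewrite drop_size_cat // take_size_cat.
Qed.

Lemma receives_Swap m n x y : size x = m -> size y = n ->
  receives (Swap m n : diagram R _ _) (y ++ x) (x ++ y).
Proof.
move=> hx hy; split; rewrite ?size_cat ?hx ?hy // => z.
move=> /size_catP[v [v' [hv hv' ->]]] /=.
rewrite drop_size_cat // take_size_cat // !eqseq_cat ?hy ?hx ?hv ?hv' //.
by rewrite andbC (eq_sym y) (eq_sym x).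
Qed.

(** * Symmetry and fusion of spider amplitudes *)

Lemma Zamp_perm s t : perm_eq s t -> Zamp R s = Zamp R t.
Proof. by move=> st; rewrite /Zamp /allbit !(perm_all _ st). Qed.

(** The two factors vanish together unless the bundle [v] is constant. With at least one wire, all
    0s and all 1s exclude each other, so the mixed terms drop out; for an empty bundle they would
    remain. *)
Lemma bsum_Zamp k s t :
  bsum k.+1 (fun v => Zamp R (s ++ v) * Zamp R (v ++ t)) = Zamp R (s ++ t).
Proof.
have E v : size v = k.+1 -> Zamp R (s ++ v) * Zamp R (v ++ t) =
    (v == nseq k.+1 false)%:R * allbit R false (s ++ t) +
    (v == nseq k.+1 true)%:R * allbit R true (s ++ t).
  move=> hv; have vE b : (v == nseq k.+1 b)%:R = allbit R b v.
    rewrite /allbit; congr (nat_of_bool _)%:R; apply/eqP/idP => [->|].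
      by rewrite all_nseq /= eqxx.
    by rewrite -hv => /all_pred1P.
  rewrite !vE /Zamp !allbit_cat.
  have v0 : allbit R false v * allbit R true v = 0.
    by case: v hv {vE} => [//|[] v] _; rewrite /allbit /= ?mul0r ?mulr0.
  have vv b : allbit R b v * allbit R b v = allbit R b v.
    by rewrite /allbit -natrM mulnb andbb.
  move: v0 (vv false) (vv true).
  set v0 := allbit R false v; set v1 := allbit R true v.
  set s0 := allbit R false s; set s1 := allbit R true s.
  set t0 := allbit R false t; set t1 := allbit R true t => v01 v00 v11.
  (* The product is grouped so that the indicators of [v] occur only as squares, which are
     idempotent, and as the mixed product, which is 0. *)
  transitivity (v0 * v0 * (s0 * t0) + v0 * v1 * (s0 * t1 + s1 * t0) +
                v1 * v1 * (s1 * t1)); first by ring.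
  by rewrite v01 v00 v11; ring.
rewrite (eq_bsum E) bsumD.
by rewrite !(bsum_delta (fun=> _)) ?size_nseq.
Qed.

(** * Soundness of the structural equations *)

(** By induction on the derivation. The size hypotheses allow boundary strings to be split along the
    tensor factors. *)
Lemma amp_diag_equiv m n (f g : diagram R m n) y x : f ≅ g ->
  size y = n -> size x = m -> amp f y x = amp g y x.
Proof.
move=> fg; elim: fg y x => {m n f g}.
- by [].
- by move=> m n f g _ IH y x hy hx; rewrite IH.
- by move=> m n f g h _ IH _ IH' y x hy hx; rewrite IH // IH'.
- move=> m n p g g' f f' _ IHg _ IHf y x hy hx /=.
  by apply: eq_bsum => z hz; rewrite IHg // IHf.
- move=> m n m' n' f f' g g' _ IHf _ IHg ? ?.
  move=> /size_catP[y [y' [hy hy' ->]]] /size_catP[x [x' [hx hx' ->]]].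
  by rewrite !amp_tens_cat // IHf // IHg.
- move=> m n p q h g f y x hy hx /=.
  under eq_bsum => z _ do rewrite -bsumZl.
  rewrite exchange_bsum; apply: eq_bsum => z hz; rewrite -bsumZr.
  by apply: eq_bsum => w hw; rewrite mulrA.
- move=> m n f y x hy hx.
  exact: (amp_comp_receives f x (receives_Idn hy)).
- move=> m n f y x hy hx.
  exact: (amp_comp_sends f y (sends_Idn hx)).
- move=> m n m' n' m'' n'' f g h ? ?.
  move=> /size_catP[y12 [y3 [/size_catP[y1 [y2 [hy1 hy2 ->]]] hy3 ->]]].
  move=> /size_catP[x12 [x3 [/size_catP[x1 [x2 [hx1 hx2 ->]]] hx3 ->]]].
  rewrite amp_castd [RHS]amp_tens_cat ?size_cat ?hy1 ?hy2 ?hx1 ?hx2 //.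
  by rewrite -!catA !amp_tens_cat // mulrA.
- by move=> m n f y x hy hx /=; rewrite !take0 !drop0 eqxx mul1r.
- move=> m n f y x hy hx; rewrite amp_castd -{1}(cats0 y) -{1}(cats0 x).
  by rewrite amp_tens_cat //= mulr1.
- move=> m n y ? hy /size_catP[x [x' [hx hx' ->]]].
  have [_ _ ->] := sends_tens (sends_Idn hx) (sends_Idn hx'); last by [].
  by [].
- move=> m n p m' n' p' g f g' f' ? ?.
  move=> /size_catP[y [y' [hy hy' ->]]] /size_catP[x [x' [hx hx' ->]]].
  rewrite amp_tens_cat // /= bsum_cat -bsumZr; apply: eq_bsum => z hz.
  rewrite -bsumZl; apply: eq_bsum => z' hz'.
  rewrite !take_size_cat // !drop_size_cat //; exact: mulrACA.
- move=> m n m' n' f g ? ?.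
  move=> /size_catP[y' [y [hy' hy ->]]] /size_catP[x [x' [hx hx' ->]]].
  rewrite (amp_comp_receives _ _ (receives_Swap hy hy')).
  by rewrite (amp_comp_sends _ _ (sends_Swap hx hx')) !amp_tens_cat // mulrC.
- move=> m n y ? hy /size_catP[x [x' [hx hx' ->]]].
  rewrite (amp_comp_sends _ _ (sends_Swap hx hx')).
  by have [_ _ ->] := sends_Swap hx' hx.
- move=> m n p y ? hy.
  move=> /size_catP[x1 [? [hx1 /size_catP[x2 [x3 [hx2 hx3 ->]]] ->]]].
  have h1 := sends_tens (sends_Swap hx1 hx2) (sends_Idn hx3).
  have h2 := sends_tens (sends_Idn hx2) (sends_Swap hx1 hx3).
  rewrite amp_castd catA.
  rewrite (amp_comp_sends _ _ (sends_castd (erefl _) (esym (addnA n m p)) h1)).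
  have h3 : size (x2 ++ x3) = (n + p)%N by rewrite size_cat hx2 hx3.
  rewrite -!catA; have [_ _ ->] := h2; last by rewrite hy addnA addnAC.
  by have [_ _ ->] := sends_Swap hx1 h3; rewrite // catA.
(* The snakes have one boundary bit at each end, so finitely many explicit sums remain. *)
- case=> [|b []] // [|a []] //= _ _; case: a; case: b;
  by rewrite /= !(mul0r, mulr0, add0r, addr0, mul1r, mulr1).
- case=> [|b []] // [|a []] //= _ _; case: a; case: b;
  by rewrite /= !(mul0r, mulr0, add0r, addr0, mul1r, mulr1).
- move=> ? [] // /size2P[a [b ->]] _.
  rewrite (amp_comp_receives _ _ (@receives_Swap 1 1 [:: b] [:: a] _ _)) //=.
  by rewrite eq_sym.
- move=> [] // ? _ /size2P[a [b ->]].
  rewrite (amp_comp_sends _ _ (@sends_Swap 1 1 [:: a] [:: b] _ _)) //=.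
  by rewrite eq_sym.
- move=> m a b ? x.
  move=> /size_catP[y1 [? [hy1 /size_catP[? [y2 [h hy2 ->]]] ->]]] hx.
  have [c [d {h}->]] := size2P h.
  have h := receives_tens (@receives_Swap 1 1 [:: d] [:: c] erefl erefl)
              (receives_Idn hy2).
  rewrite (amp_comp_receives _ _ (receives_tens (receives_Idn hy1) h)).
  apply: Zamp_perm; rewrite perm_cat2r perm_cat2l perm_cat2r.
  by rewrite (perm_catC [:: d]).
- move=> n a b y ? hy.
  move=> /size_catP[x1 [? [hx1 /size_catP[? [x2 [h hx2 ->]]] ->]]].
  have [c [d {h}->]] := size2P h.
  have h := sends_tens (@sends_Swap 1 1 [:: c] [:: d] erefl erefl)
              (sends_Idn hx2).
  rewrite (amp_comp_sends _ _ (sends_tens (sends_Idn hx1) h)).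
  apply: Zamp_perm; rewrite perm_cat2l perm_cat2l perm_cat2r.
  by rewrite (perm_catC [:: d]).
- move=> m n [//|c y] x [hy] hx.
  (* The cup carries the bit [c] on both of its legs, and the identity wires force [t] to be [x]. *)
  transitivity (bsum m (fun t => (t == x)%:R * Zamp R (y ++ c :: t)));
    last first.
    rewrite (bsum_delta (fun t => Zamp R (y ++ c :: t)) hx).
    by apply: Zamp_perm; rewrite (perm_catCA y [:: c] x).
  rewrite amp_comp (bsum_cat 2 m).
  rewrite /= -!bsumD; apply: eq_bsum => t _; rewrite !take0 !drop0.
  by case: c; rewrite /=; ring.
- move=> m n y [//|c x] hy [hx].
  transitivity (bsum n (fun t => (t == y)%:R * Zamp R (c :: t ++ x)));
    last first.
    rewrite (bsum_delta (fun t => Zamp R (c :: t ++ x)) hy).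
    by apply: Zamp_perm; rewrite (perm_catCA [:: c] y x).
  rewrite amp_comp (bsum_cat 2 n).
  rewrite /= -!bsumD; apply: eq_bsum => t _; rewrite !take0 !drop0 (eq_sym y).
  by case: c; rewrite /=; ring.
Qed.

(** * Soundness of the rules of the calculus *)

Lemma bsum1 (F : seq bool -> C) : bsum 1 F = F [:: false] + F [:: true].
Proof. by []. Qed.

Lemma amp_Lam_tens c m n (f : diagram R m n) y x :
  amp (Lam c ⊗ f)%ZQ y x = c * amp f y x.
Proof. by rewrite /= !drop0. Qed.

Lemma sends_copy a : sends (Zsp 1 2 : diagram R _ _) [:: a] [:: a; a].
Proof.
split=> // y /size2P[b [c ->]].
by case: a; case: b; case: c; rewrite /= /Zamp /allbit /= ?addr0 ?add0r.
Qed.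

Lemma receives_merge b : receives (Zsp 2 1 : diagram R _ _) [:: b] [:: b; b].
Proof.
split=> // y /size2P[a [c ->]].
by case: b; case: a; case: c; rewrite /= /Zamp /allbit /= ?addr0 ?add0r.
Qed.

(** This is i/√2, the common factor of the entries of [Qmx (uH R)], which is -i times the Hadamard
    matrix. *)
Definition Hscal : C := (Num.sqrt 2)^-1%:C%C * 'i%C.

Lemma Hscal2 : 2 * Hscal * Hscal = -1.
Proof.
rewrite /Hscal; set S := (_^-1%:C)%C.
have SS : S * S = 2^-1.
  by rewrite -rmorphM -expr2 exprVn sqr_sqrtr ?ler0n // fmorphV rmorph_nat.
have ii : 'i%C * 'i%C = -1 :> C by rewrite -expr2 sqr_i.
transitivity (2 * (S * S) * ('i%C * 'i%C)); first by ring.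
by rewrite SS ii; field.
Qed.

Lemma sqrt2_Hscal : (Num.sqrt 2)%:C%C * 'i%C = 2 * Hscal.
Proof.
have nz : Num.sqrt 2 != 0 :> R by rewrite sqrtr_eq0 -ltNge ltr0n.
have e : Num.sqrt 2 = 2 * (Num.sqrt 2)^-1 :> R.
  by apply: (mulIf nz); rewrite mulfVK // -expr2 sqr_sqrtr ?ler0n.
by rewrite [in LHS]e rmorphM rmorph_nat mulrA.
Qed.

Lemma Hscal_div : 'i%C / (Num.sqrt 2)%:C%C = Hscal.
Proof. by rewrite mulrC /Hscal fmorphV. Qed.

Lemma Qamp_H b a : Qamp (uH R) b a = (-1) ^+ (b && a).+1 * Hscal.
Proof.
by case: b; case: a; rewrite !/Qamp /Hscal /=; simpc.
Qed.

Lemma Qamp_rotz (alpha : R) b a :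
  b != a -> Qamp (axis_angle alpha 0 0 1) b a = 0.
Proof. by case: b; case: a => // _; rewrite /Qamp /= !mulr0 ?oppr0. Qed.

Lemma amp_ZQ_rule m n (f g : diagram R m n) y x : ZQ_rule f g ->
  size y = n -> size x = m -> amp f y x = amp g y x.
Proof.
move=> fg; case: fg y x => {m n f g}.
- move=> a b c d k ? ?.
  move=> /size_catP[y [y' [hy hy' ->]]] /size_catP[x [x' [hx hx' ->]]].
  (* The intermediate string is [u ++ v ++ t]: outputs of the first spider, connecting bundle,
     inputs of the second. Identity wires fix [u] and [t], leaving the sum over [v] to
     [bsum_Zamp]. *)
  transitivity (bsum b (fun u => (u == y)%:R * bsum k.+1 (fun v =>
    bsum c (fun t => (t == x')%:R *
      (Zamp R (y' ++ v ++ t) * Zamp R ((u ++ v) ++ x)))))).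
    rewrite amp_comp bsum_cat; apply: eq_bsum => u hu.
    rewrite bsum_cat -bsumZl; apply: eq_bsum => v hv.
    rewrite -bsumZl; apply: eq_bsum => t ht.
    rewrite amp_castd amp_tens_cat // catA amp_tens_cat ?size_cat ?hu ?hv //=.
    by rewrite (eq_sym y); ring.
  rewrite (bsum_delta (fun u => bsum k.+1 (fun v => bsum c (fun t =>
    (t == x')%:R * (Zamp R (y' ++ v ++ t) * Zamp R ((u ++ v) ++ x))))) hy).
  transitivity (bsum k.+1 (fun v =>
    Zamp R ((y' ++ x') ++ v) * Zamp R (v ++ (y ++ x)))).
    apply: eq_bsum => v hv.
    rewrite (bsum_delta
      (fun t => Zamp R (y' ++ v ++ t) * Zamp R ((y ++ v) ++ x)) hx').
    congr (_ * _); apply: Zamp_perm.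
      by rewrite -catA perm_cat2l perm_catC.
    by rewrite -catA perm_catCA.
  rewrite bsum_Zamp; apply: Zamp_perm.
  by apply/permP => p; rewrite !count_cat; ring.
- move=> q1 q2 ? ? /size1P[b ->] /size1P[a ->].
  case: q1 q2 => [q1 h1] [q2 h2]; rewrite /= !/Qamp.
  by case: a; case: b; rewrite /=; simpc; congr (_ +i* _)%C; ring.
- move=> q ? ? /size1P[b ->] /size1P[a ->].
  (* The cup ties the input of [q] to the output bit [b], and the cap ties its output to the input
     bit [a]. *)
  transitivity (Qamp q a b).
    by case: a; case: b; rewrite /= !(mul0r, mulr0, add0r, addr0, mul1r, mulr1).
  by case: a; case: b; rewrite [LHS]/Qamp [RHS]/Qamp /= ?opprK.
- move=> q ? ? /size1P[b ->] /size1P[a ->].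
  case: q => [q h]; case: a; case: b; rewrite /= !/Qamp /=; simpc;
  by congr (_ +i* _)%C; ring.
- move=> ? ? /size1P[b ->] /size1P[a ->].
  by case: a; case: b; apply/eqP; rewrite eq_complex !/Qamp /= ?oppr0 !eqxx.
- move=> ? ? /size1P[b ->] /size1P[a ->].
  by case: a; case: b; rewrite /= /Zamp /allbit /= ?addr0 ?add0r.
- move=> q ? ? /size0nil -> /size0nil ->.
  rewrite /= /Zamp /allbit /Qamp /=; simpc; congr (_ +i* _)%C; ring.
- by [].
- by move=> ? ? /size0nil -> /size0nil ->.
- move=> ? ? /size2P[b [d ->]] /size2P[a [c ->]].
  rewrite amp_Lam_tens.
  (* Copying and swapping yield the bits a, c, a, c, and the merges read b, b, d, d; the left side
     becomes a product of four entries of H. *)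
  rewrite (amp_comp_sends _ _ (sends_tens (sends_copy a) (sends_copy c))).
  have h := sends_tens (@sends_Idn 1 [:: a] erefl)
    (sends_tens (@sends_Swap 1 1 [:: a] [:: c] erefl erefl)
       (@sends_Idn 1 [:: c] erefl)).
  rewrite (amp_comp_sends _ _ h) {h}.
  have h := receives_tens (receives_merge b) (receives_merge d).
  rewrite (amp_comp_receives _ _ h) {h}.
  (* Reassociation isolates [Zsp 2 1] with the lower pair of H, so that its single output bit is the
     first summation variable. *)
  rewrite -(amp_diag_equiv (de_compA _ _ _)) // amp_comp bsum1.
  rewrite !(amp_comp_receives _ _ (receives_merge _)).
  rewrite !amp_comp !bsum1 !(amp_comp_sends _ _ (sends_copy _)) /=.
  rewrite !Qamp_H mulNr sqrt2_Hscal.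
  (* Both sides are homogeneous of degree 5 in [Hscal], so its value does not matter here. *)
  by case: b; case: d; case: a; case: c; rewrite /=; ring.
- move=> ? ? /size0nil -> /size2P[a [c ->]].
  rewrite amp_Lam_tens Hscal_div /= !Qamp_H /Zamp /allbit.
  case: a; case: c; rewrite /=; [ring | ring | ring |].
  (* Both inputs are 0 here. In the other cases both sides vanish or cancel formally, since the
     column of H at 1 sums to 0; here the degrees in [Hscal] differ and [Hscal2] is needed. *)
  transitivity (2 * Hscal * (2 * Hscal * Hscal)); last by ring.
  by rewrite Hscal2; ring.
- move=> alpha ? ? /size1P[b ->] /size2P[a [c ->]].
  rewrite !(amp_comp_receives _ _ (receives_merge _)) /=.
  (* Since z-rotations are diagonal, both sides vanish unless all three bits agree, and then they
     coincide. *)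
  by case: b; case: a; case: c;
    rewrite /= ?(mul1r, mulr1, mul0r, mulr0) // Qamp_rotz.
Qed.

End Soundness.

Theorem theorem6p15 (R : realType) (m n : nat) (lhs rhs D1 D2 : diagram R m n)
  (Hrule : ZQ_rule lhs rhs) (H1 : D1 ≅ lhs) (H2 : D2 ≅ rhs) :
  interp D1 = interp D2.
Proof.
apply/matrixP => i j.
have [y hy iE] := bval_surj i; have [x hx jE] := bval_surj j.
have -> : i = bord hy by apply: val_inj.
have -> : j = bord hx by apply: val_inj.
rewrite !amp_interp (amp_diag_equiv H1) // (amp_diag_equiv H2) //.
exact: amp_ZQ_rule.
Qed.
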